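(* Let $k$ be a positive integer and let $G$ be an edge-colored graph on $n$ vertices such that $\sum_{v\in V(G)} d^c_G(v)\geq \binom{n+1}{2}+k-1$. Then $G$ contains (at least) $k$ rainbow triangles.
   Context: Graphs are finite, simple, undirected and have at least one vertex. An edge-colored graph is a graph together with an arbitrary (not necessarily proper) assignment of a color to each edge. For a vertex $v$ of $G$, the color degree $d^c_G(v)$ is the number of distinct colors appearing on the edges of $G$ incident to $v$. A subgraph is rainbow if all its edges have pairwise distinct colors; rainbow triangles are counted as distinct subgraphs (by their vertex sets). *)

(* Defs.v *)
From mathcomp Require Import all_boot.

Set Implicit Arguments.
Unset Strict Implicit.
Unset Printing Implicit Defensive.

Record sgraph (V : finType) := SGraph {
  edge_set : {set {set V}};
  edge_set2 : forall e, e \in edge_set -> #|e| = 2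
}.

Notation edge G := {e : {set _} | e \in edge_set G}.

Section EdgeColored.
Variables (V : finType) (G : sgraph V) (C : eqType) (col : edge G -> C).

Definition color_degree (v : V) : nat :=
  size (undup [seq col e | e : edge G in [pred e : edge G | v \in val e]]).

Definition rainbow (F : {set edge G}) : bool :=
  [forall e in F, forall f in F, (e != f) ==> (col e != col f)].

Definition is_triangle (S : {set V}) : bool :=
  (#|S| == 3) &&
  [forall x in S, forall y in S, (x != y) ==> ([set x; y] \in edge_set G)].

(* When S is a triangle these are exactly its three edges. *)
Definition edges_within (S : {set V}) : {set edge G} :=
  [set e : edge G | val e \subset S].

(* A triangle subgraph is determined by its vertex set, so rainbow triangles
   are counted as vertex sets. *)
Definition rainbow_triangles : {set {set V}} :=
  [set S : {set V} | is_triangle S && rainbow (edges_within S)].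

End EdgeColored.

(* Main.v *)
(** Give each connected component of each color class its own color.  Color
    degrees and rainbow triangles are unchanged, and since a component with m
    edges has at most m + 1 vertices, the sum of the color degrees is at most
    e + c, the number of edges plus the number of (new) colors.

    It remains to see that e + c >= C(n+1, 2) + k forces more than k rainbow
    triangles.  Identifying two colors of a rainbow triangle lowers c by one,
    destroys that triangle and creates none, so k = 0 suffices.  Call a color
    saturated at v if all its edges contain v, and let s(v) be the number of
    such colors.  Deleting v lowers e + c by at most d(v) + s(v), so by
    induction on n we may assume d(v) + s(v) > n for all v, whence s(v) > 0.
    If there is no rainbow triangle, picking one neighbor of v along each
    saturated color gives an independent set T of size s(v); any u in T has
    d(u) <= n - s(v), hence s(u) > s(v), which is absurd for s(v) maximal. *)

Require Import Defs.
From mathcomp Require Import all_boot.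
From mathcomp Require Import zify.

Set Implicit Arguments.
Unset Strict Implicit.
Unset Printing Implicit Defensive.

(** * Extremal bound on edges plus colors *)

Section EdgesPlusColors.
Variables (V D : finType).
Implicit Types (A S : {set V}) (E : {set {set V}}) (f : {set V} -> D).

(** Colors are given to all vertex sets, not to a subtype of edges, so that deleting a vertex
    changes only [E] and merging colors changes only [f]. *)
Definition rainbow_triples E f : {set {set V}} :=
  [set S : {set V} | [&& #|S| == 3,
    [forall x in S, forall y in S, (x != y) ==> ([set x; y] \in E)] &
    [forall e in E, forall g in E,
      [&& e \subset S, g \subset S & e != g] ==> (f e != f g)]]].

Definition nbrs E (v : V) : {set V} := [set u | [set v; u] \in E].

Definition saturated_colors E f (v : V) : {set D} :=
  [set c in f @: E | [forall e in E, (f e == c) ==> (v \in e)]].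

Lemma mem_saturated E f v e :
  e \in E -> f e \in saturated_colors E f v -> v \in e.
Proof.
move=> eE; rewrite inE => /andP[_ /forall_inP/(_ e eE)].
by rewrite eqxx.
Qed.

Section TwoSets.
Variable E : {set {set V}}.
Hypothesis E2 : forall e, e \in E -> #|e| = 2.

Lemma edge_neq u v : [set u; v] \in E -> u != v.
Proof. by move/E2; rewrite cards2; case: (u != v). Qed.

Lemma edge_at v e : e \in E -> v \in e -> exists2 u, u != v & e = [set v; u].
Proof.
move=> /E2/eqP/cards2P[x [y [xy ->]]]; rewrite !inE => /orP[]/eqP->.
- by exists y; rewrite // eq_sym.
- by exists x; rewrite // setUC.
Qed.

Lemma card_edges_at v : #|[set e in E | v \in e]| <= #|nbrs E v|.
Proof.
apply: leq_trans (leq_imset_card (fun u => [set v; u]) _).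
apply/subset_leq_card/subsetP => e; rewrite inE => /andP[eE ve].
have [u _ def_e] := edge_at eE ve.
by apply/imsetP; exists u; rewrite ?inE -?def_e.
Qed.

(** A color not saturated at [v] has an edge avoiding [v], so it survives in [E']. *)
Lemma deletion_bound f v (E' := [set e in E | v \notin e]) :
  #|E| + #|f @: E| <=
    #|E'| + #|f @: E'| + (#|nbrs E v| + #|saturated_colors E f v|).
Proof.
have cE : #|E| <= #|E'| + #|nbrs E v|.
  rewrite -(cardsID [set e : {set V} | v \in e] E) addnC leq_add //.
  - by apply/subset_leq_card/subsetP => e; rewrite !inE andbC.
  - rewrite (leq_trans _ (card_edges_at v)) //.
    by apply/subset_leq_card/subsetP => e; rewrite !inE.
suff cf : #|f @: E| <= #|f @: E'| + #|saturated_colors E f v| by lia.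
rewrite (leq_trans _ (leq_card_setU _ _)) //.
apply/subset_leq_card/subsetP => c cfE; rewrite in_setU.
case: (boolP (c \in saturated_colors _ _ _)); first by rewrite orbT.
rewrite inE cfE => /= /forall_inPn[e eE].
rewrite negb_imply => /andP[/eqP <- ve].
by rewrite imset_f // inE eE.
Qed.

Lemma rainbow_triples0P f x y z :
  rainbow_triples E f = set0 ->
  [set x; y] \in E -> [set y; z] \in E -> [set x; z] \in E ->
  [|| f [set x; y] == f [set y; z], f [set y; z] == f [set x; z]
    | f [set x; y] == f [set x; z]].
Proof.
move=> no_rt xyE yzE xzE.
have [xy yz xz] := And3 (edge_neq xyE) (edge_neq yzE) (edge_neq xzE).
apply: contra_eqT no_rt; rewrite !negb_or => /and3P[c1 c2 c3].
apply/set0Pn; exists (x |: [set y; z]); rewrite inE; apply/and3P; split.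
- by rewrite cardsU1 cards2 !inE negb_or xy xz yz.
- apply/forall_inP => a aS; apply/forall_inP => b bS; apply/implyP => ab.
  move: aS bS ab; rewrite !inE.
  by move=> /or3P[]/eqP-> /or3P[]/eqP->; rewrite ?eqxx // => _; rewrite // setUC.
have sub e : e \in E -> e \subset x |: [set y; z] ->
    [\/ e = [set x; y], e = [set y; z] | e = [set x; z]].
  move=> /E2/eqP/cards2P[a [b [ab ->]]].
  rewrite subUset !sub1set !inE => /andP[].
  move=> /or3P[]/eqP ea /or3P[]/eqP eb; move: ab; rewrite ea eb ?eqxx // => _;
    first [exact: Or31 | exact: Or32 | exact: Or33
          | rewrite setUC; first [exact: Or31 | exact: Or32 | exact: Or33]].
apply/forall_inP => e eE; apply/forall_inP => g gE.
apply/implyP => /and3P[/(sub e eE) De /(sub g gE) Dg].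
by case: De => ->; case: Dg => ->; rewrite ?eqxx // => _; rewrite // eq_sym.
Qed.

Lemma saturated_transversal f v : exists T : {set V},
  [/\ #|T| = #|saturated_colors E f v|, T \subset nbrs E v,
      {in T, forall u, f [set v; u] \in saturated_colors E f v} &
      {in T &, injective (fun u => f [set v; u])}].
Proof.
(* [h c] is the far end of an edge at [v] of color [c]; for saturated [c] the pick succeeds, so the
   default [v] does not occur. *)
pose h c := odflt v [pick u in nbrs E v | f [set v; u] == c].
have hP c : c \in saturated_colors E f v ->
    (h c \in nbrs E v) /\ f [set v; h c] = c.
  move=> cs; have := cs; rewrite inE => /andP[/imsetP[e eE ec] _].
  rewrite ec in cs *.
  have [u _ def_e] := edge_at eE (mem_saturated eE cs).
  rewrite /h; case: pickP => [w /andP[? /eqP]|/(_ u)] //=.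
  by rewrite inE -def_e eE eqxx.
exists (h @: saturated_colors E f v); split.
- apply: card_in_imset => c d /hP[_ {2}<-] /hP[_ {2}<-] ->; done.
- by apply/subsetP => _ /imsetP[c /hP[? _] ->].
- by move=> _ /imsetP[c cs ->]; have [_ ->] := hP c cs.
- by move=> _ _ /imsetP[c /hP[_ ec] ->] /imsetP[d /hP[_ ed] ->]; rewrite ec ed => ->.
Qed.

(* A transversal of the saturated colors at v is an independent set: the third
   edge of a triangle at v would have to repeat one of two colors that only
   occur at v. *)
Lemma saturated_color_increase f A v :
  (forall e, e \in E -> e \subset A) ->
  rainbow_triples E f = set0 ->
  0 < #|saturated_colors E f v| ->
  exists2 u, u \in A & #|nbrs E u| + #|saturated_colors E f v| <= #|A|.
Proof.
move=> EA no_rt; have [T [<- TN Tsat Tinj]] := saturated_transversal f v.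
case/card_gt0P => u uT; have uN := subsetP TN u uT.
have NA w x : x \in nbrs E w -> x \in A.
  by rewrite inE => /EA/subsetP; apply; rewrite !inE eqxx orbT.
exists u; first exact: NA uN.
have /eqP dis : nbrs E u :&: T == set0.
  apply/set0Pn => -[w /setIP[wu wT]].
  have wN := subsetP TN w wT; rewrite !inE in uN wN wu.
  have uw := edge_neq wu.
  have vuw : v \notin [set u; w].
    by rewrite !inE negb_or (edge_neq uN) (edge_neq wN).
  have sat x : x \in T -> f [set u; w] != f [set v; x].
    move=> xT; apply: contraNneq vuw => eq_f.
    by apply: (@mem_saturated E f) => //; rewrite eq_f Tsat.
  have := rainbow_triples0P no_rt uN wu wN.
  rewrite eq_sym (negPf (sat u uT)) (negPf (sat w wT)) /= => /eqP/(Tinj _ _ uT wT).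
  by move/eqP; rewrite (negPf uw).
(* [nbrs E u] and [T] are disjoint subsets of [A], so their sizes add up to at most that of [A]. *)
have := cardsUI (nbrs E u) T; rewrite dis cards0 addn0 => <-.
apply/subset_leq_card; rewrite subUset; apply/andP; split.
- by apply/subsetP => w; apply: NA.
- by apply: subset_trans TN _; apply/subsetP => w; apply: NA.
Qed.

End TwoSets.

(** Every pair of vertices of a triangle of the smaller graph is an edge there, so no edge of [E]
    inside it has been deleted. *)
Lemma rainbow_triples_vertex_deletion E f v :
  (forall e, e \in E -> #|e| = 2) ->
  rainbow_triples [set e in E | v \notin e] f \subset rainbow_triples E f.
Proof.
move=> E2.
apply/subsetP => S; rewrite !inE => /and3P[S3 adjS rbS].
have subE e : e \in E -> e \subset S -> e \in [set e in E | v \notin e].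
  move=> /E2/eqP/cards2P[x [y [xy ->]]]; rewrite subUset !sub1set => /andP[xS yS].
  by move/forall_inP/(_ x xS)/forall_inP/(_ y yS): adjS; rewrite xy.
apply/and3P; split=> //.
- apply/forall_inP => x xS; apply/forall_inP => y yS; apply/implyP => xy.
  by move/forall_inP/(_ x xS)/forall_inP/(_ y yS): adjS; rewrite xy inE => /andP[].
apply/forall_inP => e eE; apply/forall_inP => g gE.
apply/implyP => /and3P[eS gS eg].
move/forall_inP/(_ e (subE e eE eS))/forall_inP/(_ g (subE g gE gS)): rbS.
by rewrite eS gS eg.
Qed.

(** The vertex set is a subset [A] of a fixed type, so that the induction can delete vertices. *)
Lemma no_rainbow_bound E f A :
  A != set0 ->
  (forall e, e \in E -> #|e| = 2) -> (forall e, e \in E -> e \subset A) ->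
  rainbow_triples E f = set0 ->
  #|E| + #|f @: E| < 'C(#|A|.+1, 2).
Proof.
have [n] := ubnP #|A|; elim: n A E => // n IHn A E ltAn A0 E2 EA no_rt.
have [/eqP A1|A1] := leqP #|A| 1.
  have -> : E = set0.
    apply/setP => e; rewrite in_set0; apply/negP => eE.
    by have := subset_leq_card (EA e eE); rewrite E2 //; lia.
  rewrite imset0 !cards0 bin_gt0.
  by have := A0; rewrite -card_gt0; lia.
case: (pickP [pred v in A | #|nbrs E v| + #|saturated_colors E f v| <= #|A|]).
  move=> v /andP[/= vA small].
  pose E' := [set e in E | v \notin e].
  have cA : #|A| = #|A :\ v|.+1 by rewrite (cardsD1 v A) vA.
  have : #|E'| + #|f @: E'| < 'C(#|A :\ v|.+1, 2).
    apply: IHn.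
    - by lia.
    - by rewrite -card_gt0; lia.
    - by move=> e; rewrite inE => /andP[/E2].
    - move=> e; rewrite inE => /andP[/EA eA ve]; apply/subsetP => x xe.
      rewrite !inE (subsetP eA) // andbT.
      by apply: contraNneq ve => <-.
    - apply/eqP; rewrite -subset0 -no_rt.
      exact: rainbow_triples_vertex_deletion.
  (* By Pascal's rule the bound drops by exactly the loss allowed in [small]. *)
  have -> : 'C(#|A|.+1, 2) = 'C(#|A :\ v|.+1, 2) + #|A| by rewrite binS bin1 -cA.
  by have := deletion_bound E2 f v; rewrite /= -/E'; lia.
move=> large; have {}large v : v \in A ->
    #|A| < #|nbrs E v| + #|saturated_colors E f v|.
  by move=> vA; move: (large v); rewrite /= vA /= => /negbT; rewrite -ltnNge.
have /set0Pn[v0 v0A] := A0.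
case: (arg_maxnP (fun v => #|saturated_colors E f v|) v0A) => v vA vmax.
have sat_gt0 : 0 < #|saturated_colors E f v|.
  have : #|nbrs E v| <= #|A|.
    apply/subset_leq_card/subsetP => x; rewrite inE => /EA/subsetP; apply.
    by rewrite !inE eqxx orbT.
  by have := large v vA; lia.
(* Comparing with [large] at [u] gives [u] more saturated colors than [v], against [vmax]. *)
have [u uA] := saturated_color_increase E2 EA no_rt sat_gt0.
by have := large u uA; have := vmax u uA; lia.
Qed.

(** Edges of equal color stay equal after merging, so no rainbow triangle appears, while [S] now has
    [e] and [g] of one color. *)
Lemma rainbow_triples_merge E f S e g
    (f' := fun h => if f h == f e then f g else f h) :
  e \in E -> g \in E -> e \subset S -> g \subset S -> e != g ->
  S \in rainbow_triples E f ->
  rainbow_triples E f' \proper rainbow_triples E f.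
Proof.
move=> eE gE eS gS eg SE; apply/properP; split; last first.
  exists S => //; rewrite inE; apply/negP => /and3P[_ _].
  move/forall_inP/(_ e eE)/forall_inP/(_ g gE).
  rewrite eS gS eg /f' eqxx /=; case: (_ == f e); by rewrite eqxx.
apply/subsetP => R; rewrite !inE => /and3P[-> -> /= rb].
apply/forall_inP => a aE; apply/forall_inP => b bE; apply/implyP => ab.
move/forall_inP/(_ a aE)/forall_inP/(_ b bE): rb; rewrite ab /=.
by apply: contraNneq => eq_f; rewrite /f' eq_f.
Qed.

Lemma card_merge_colors E f e g
    (f' := fun h => if f h == f e then f g else f h) :
  #|f @: E| <= #|f' @: E|.+1.
Proof.
rewrite -add1n -(cards1 (f e)) (leq_trans _ (leq_card_setU _ _)) //.
apply/subset_leq_card/subsetP => _ /imsetP[h hE ->]; rewrite in_setU1.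
case: (altP eqP) => //= hne; apply/imsetP; exists h => //.
by rewrite /f' (negPf hne).
Qed.

Lemma rainbow_triples_count E f k :
  0 < #|V| -> (forall e, e \in E -> #|e| = 2) ->
  'C(#|V|.+1, 2) + k <= #|E| + #|f @: E| ->
  k < #|rainbow_triples E f|.
Proof.
move=> V0 E2; elim: k f => [|k IHk] f hk.
  rewrite card_gt0; apply/negP => /eqP no_rt.
  have : #|E| + #|f @: E| < 'C(#|[set: V]|.+1, 2).
    by apply: no_rainbow_bound => //; rewrite -card_gt0 cardsT.
  by rewrite cardsT; lia.
(* The induction hypothesis serves twice: here for [f], to find a rainbow triangle to destroy, and
   at the end for the merged coloring. *)
have /card_gt0P[S SE] : 0 < #|rainbow_triples E f|.
  by apply: leq_ltn_trans (IHk f _) => //; lia.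
have [e [g [eE gE eS gS eg]]] : exists e, exists g,
    [/\ e \in E, g \in E, e \subset S, g \subset S & e != g].
  have := SE; rewrite inE => /and3P[/eqP S3 adjS _].
  have /card_gt2P[x [y [z [[xS yS zS] [xy yz zx]]]]] : 2 < #|S| by rewrite S3.
  have adj a b : a \in S -> b \in S -> a != b -> [set a; b] \in E.
    by move=> aS bS; move/forall_inP/(_ a aS)/forall_inP/(_ b bS)/implyP: adjS; apply.
  exists [set x; y], [set x; z]; split.
  - exact: adj.
  - by apply: adj; rewrite // eq_sym.
  - by rewrite subUset !sub1set xS.
  - by rewrite subUset !sub1set xS.
  - apply/negP => /eqP/setP/(_ y); rewrite !inE eqxx orbT (negPf yz).
    by rewrite eq_sym (negPf xy).
have := proper_card (rainbow_triples_merge eE gE eS gS eg SE).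
apply: leq_ltn_trans; apply: IHk.
by have := card_merge_colors E f e g; lia.
Qed.

End EdgesPlusColors.

(** * Color degrees and components of color classes *)

Lemma size_undup_map_le (T C D : eqType) (f : T -> C) (h : T -> D) (s : seq T) :
  {in s &, forall x y, h x = h y -> f x = f y} ->
  size (undup (map f s)) <= size (undup (map h s)).
Proof.
elim: s => //= x s IHs fh.
have {}IHs : size (undup (map f s)) <= size (undup (map h s)).
  by apply: IHs => y z ys zs; apply: fh; rewrite inE ?ys ?zs orbT.
case: ifPn => fx; case: ifPn => hx //=; first exact: leqW.
case/negP: fx; case/mapP: hx => y ys hxy; apply/mapP; exists y => //.
by apply: fh => //; rewrite inE ?eqxx ?ys ?orbT.
Qed.

Section ColorComponents.
Variables (V : finType) (G : sgraph V) (C : eqType) (col : edge G -> C).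
Implicit Types (e g h : edge G) (X : {set edge G}).

Definition color_adj : rel (edge G) :=
  fun e g => (col e == col g) && (val e :&: val g != set0).

(** The trivial condition [g in setT] matches the shape of the blocks in
    [equivalence_partitionP]. *)
Definition color_component e : {set edge G} :=
  [set g in setT | connect color_adj e g].

Definition vertices_of X : {set V} := \bigcup_(e in X) val e.

Lemma color_adj_sym : symmetric color_adj.
Proof. by move=> e g; rewrite /color_adj eq_sym setIC. Qed.

Lemma color_component_col e g : g \in color_component e -> col g = col e.
Proof.
rewrite !inE => /connectP[p]; elim: p e => [|h p IHp] e /= => [_ -> //|].
by case/andP=> /andP[/eqP -> _]; apply: IHp.
Qed.

Lemma color_component_refl e : e \in color_component e.
Proof. by rewrite !inE connect0. Qed.

Lemma color_component_eq e g : color_adj e g -> color_component e = color_component g.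
Proof.
move=> eg; apply/setP => h; rewrite !inE /=.
exact/same_connect/connect1/eg/sym_connect_sym/color_adj_sym.
Qed.

(** A maximal part [X] of the component that contains [e] and satisfies the bound is closed under
    adjacency, hence is the whole component. *)
Lemma card_vertices_of_component e :
  #|vertices_of (color_component e)| <= #|color_component e|.+1.
Proof.
pose P X := [&& e \in X, X \subset color_component e
               & #|vertices_of X| <= #|X|.+1].
have P1 : P [set e].
  rewrite /P set11 sub1set color_component_refl /vertices_of big_set1 cards1.
  by rewrite (edge_set2 (valP e)).
have [X /maxsetP[/and3P[eX Xsub cX] Xmax] _] := maxset_exists P1.
suff -> : color_component e = X by [].
apply/eqP; rewrite eqEsubset Xsub andbT.
have clX : closed color_adj [in X].
  apply: intro_closed; first exact/sym_connect_sym/color_adj_sym.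
  move=> g h gh gX; apply: contraT => hX.
  suff PX : P (h |: X).
    by rewrite -(Xmax _ PX (subsetU1 _ _)) setU11 in hX.
  apply/and3P; split; first by rewrite setU1r.
    rewrite subUset Xsub sub1set !inE andbT /=.
    have := subsetP Xsub g gX; rewrite !inE /= => /connect_trans; apply.
    exact: connect1.
  rewrite /vertices_of big_setU1 // -/(vertices_of X) cardsU1 hX.
  have gsub : val g \subset vertices_of X by apply: bigcup_sup.
  (* One end of [h] is already covered, so adding [h] to [X] brings at most one new vertex. *)
  have : 0 < #|val h :&: vertices_of X|.
    rewrite card_gt0; case/andP: gh => _ /set0Pn[x /setIP[xg xh]].
    by apply/set0Pn; exists x; rewrite inE xh (subsetP gsub).
  by rewrite cardsU (edge_set2 (valP h)); lia.
apply/subsetP => g; rewrite !inE /= => eg.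
by have := closed_connect clX eg; rewrite /= eX => <-.
Qed.

Lemma color_component_partition :
  partition (color_component @: setT) [set: edge G].
Proof.
apply: equivalence_partitionP => e g h _ _ _; split; first exact: connect0.
by move=> eg; apply/same_connect/eg/sym_connect_sym/color_adj_sym.
Qed.

(** A component determines its color, so distinct colors at [v] come from distinct components
    through [v]. *)
Lemma color_degree_le v :
  color_degree col v <=
    #|[set K in color_component @: setT | v \in vertices_of K]|.
Proof.
pose s := enum [pred e : edge G | v \in val e].
have le1 : color_degree col v <= size (undup (map color_component s)).
  apply: size_undup_map_le => e g _ _ eq_eg.
  by apply: color_component_col; rewrite -eq_eg color_component_refl.
apply: leq_trans le1 _.
rewrite -(card_uniqP (undup_uniq _)).
apply/subset_leq_card/subsetP => K; rewrite mem_undup => /mapP[e].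
rewrite mem_enum => ve ->; rewrite inE imset_f //=.
by apply/bigcupP; exists e => //; apply: color_component_refl.
Qed.

(** Incidences between vertices and components are counted twice; the components partition the
    edges, and each adds one to its edge count. *)
Lemma sum_color_degree_le :
  \sum_(v : V) color_degree col v <=
    #|edge_set G| + #|color_component @: setT|.
Proof.
pose KK := color_component @: setT.
have le1 : \sum_v color_degree col v <= \sum_(K in KK) #|vertices_of K|.
  apply: (@leq_trans (\sum_v \sum_(K in KK) (v \in vertices_of K))).
    apply: leq_sum => v _; apply: leq_trans (color_degree_le v) _.
    rewrite -sum1_card big_mkcond [leqRHS]big_mkcond /=.
    by apply: leq_sum => K _; rewrite inE; case: (K \in _); case: (v \in _).
  rewrite exchange_big; apply: leq_sum => K _.
  by rewrite -sum1_card [leqRHS]big_mkcond; apply: leq_sum => v _; case: ifP.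
apply: leq_trans le1 _.
have -> : #|edge_set G| = \sum_(K in KK) #|K|.
  by rewrite -(card_partition color_component_partition) cardsT card_sig.
rewrite -[#|_ @: _|]sum1_card -big_split /=; apply: leq_sum => _ /imsetP[e _ ->].
by rewrite addn1; apply: card_vertices_of_component.
Qed.

(** The components as a coloring of all vertex sets, with the empty set as filler on non-edges. *)
Definition component_color (s : {set V}) : {set edge G} :=
  if insub s is Some e then color_component e else set0.

Lemma component_color_val e : component_color (val e) = color_component e.
Proof. by rewrite /component_color valK. Qed.

Lemma rainbow_triples_component_color :
  rainbow_triples (edge_set G) component_color \subset rainbow_triangles col.
Proof.
apply/subsetP => S; rewrite !inE => /and3P[S3 adjS rb].
rewrite /is_triangle S3 adjS /=.
apply/forall_inP => e; rewrite inE => eS; apply/forall_inP => g; rewrite inE => gS.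
apply/implyP => eg; apply/negP => /eqP eq_col.
move/forall_inP/(_ _ (valP e))/forall_inP/(_ _ (valP g)): rb.
rewrite eS gS (inj_eq val_inj) eg /= => /negP; apply; apply/eqP.
rewrite !component_color_val; apply: color_component_eq.
rewrite /color_adj eq_col eqxx andTb -card_gt0.
(* Two disjoint edges would need four vertices inside the three of [S]. *)
have /subset_leq_card : val e :|: val g \subset S by rewrite subUset eS.
rewrite cardsU (edge_set2 (valP e)) (edge_set2 (valP g)) (eqP S3).
by apply: contraLR; rewrite -eqn0Ngt => /eqP->.
Qed.

End ColorComponents.

Theorem theorem4 (k n : nat) (V : finType) (G : sgraph V)
    (C : eqType) (col : edge G -> C) :
  0 < k -> 0 < n -> #|V| = n ->
  'C(n + 1, 2) + k - 1 <= \sum_(v : V) color_degree col v ->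
  k <= #|rainbow_triangles col|.
Proof.
(* From here [k] is the predecessor, which absorbs the [- 1] and turns the goal into more than [k]
   triangles. *)
case: k => // k _ n0 cV hsum.
have colors_le : #|color_component col @: setT|
    <= #|component_color col @: edge_set G|.
  apply/subset_leq_card/subsetP => _ /imsetP[e _ ->].
  by rewrite -component_color_val imset_f // (valP e).
apply: leq_trans (subset_leq_card (rainbow_triples_component_color col)).
apply: rainbow_triples_count.
- by rewrite cV.
- exact: edge_set2.
have := sum_color_degree_le col; rewrite cV -addn1.
by lia.
Qed.
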